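(* Let $\mathcal{T}=(V,A,E,f,q,v_0)$ be a decorated rooted tree such that $f(\alpha)\in\{0,1\}$ for all $\alpha\in A$. Let $n=\delta_{v_0}$, assume $n\ge1$, let $\mathcal{T}_1,\dots,\mathcal{T}_n$ be the decorated trees attached to $\mathcal{T}$ as described in the context, and let $d=\deg(\mathcal{T})$. Then $$g(\mathcal{T})=\frac{(d-1)(d-2)}{2}-\sum_{i=1}^n\delta(\mathcal{T}_i).$$
   Context: A graph is a pair $(X_0,X_1)$ of finite sets such that each element of $X_1$ (an edge) is a $2$-element subset of $X_0$; elements of $X_0$ are cells. The valency $\delta_x$ of a cell is the number of edges containing it. A path is a tuple $(x_0,\dots,x_n)$ ($n\ge0$) of cells with $\{x_i,x_{i+1}\}$ an edge for each $i<n$, these edges pairwise distinct; a cell/edge is in the path if it is some $x_i$ / some $\{x_i,x_{i+1}\}$. The graph is a tree if any two cells $x,y$ are joined by a unique path $\gamma_{x,y}$. A decorated tree is $(V,A,E,f,q)$ with $V$ (vertices), $A$ (arrows) finite disjoint sets, $(V\cup A,E)$ a tree, every arrow of valency $1$, $f:A\to\mathbb{Z}$, $q(e,x)\in\mathbb{Z}$ for each $e\in E$, $x\in e$, with $q(e,\alpha)=1$ for $\alpha\in A$, and for each $v\in V$ and distinct edges $e,e'\ni v$, $\gcd(q(e,v),q(e',v))=1$. $A_0=\{\alpha\in A:f(\alpha)=0\}$. For $x\in V\cup A$, $e\ni x$: $Q(e,x)=\prod q(e',x)$ over edges $e'\ne e$ containing $x$ (empty product $=1$); for an edge $e=\{x,y\}$,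 $\det(e)=q(e,x)q(e,y)-Q(e,x)Q(e,y)$. An edge $\varepsilon$ is incident to a path $\gamma$ if it is not in $\gamma$ but contains a cell $u$ of $\gamma$; $q(\varepsilon,\gamma):=q(\varepsilon,u)$. For $v\ne\alpha$, $v\in V\cup A$, $\alpha\in A$: $x_{v,\alpha}=f(\alpha)\prod_\varepsilon q(\varepsilon,\gamma_{v,\alpha})$ over edges incident to $\gamma_{v,\alpha}$; $\hat x_{v,\alpha}$ the same with product restricted to $\varepsilon\not\ni v$. For $v\in V\cup A_0$, $N_v=\sum_{\alpha\in A\setminus A_0}x_{v,\alpha}$; $M(\mathcal{T})=-\sum_{v\in V\cup A_0}N_v(\delta_v-2)$. For $u\in V\cup A$, $e\ni u$: $p(u,e)=\sum\hat x_{u,\alpha}$ over $\alpha\in A\setminus A_0$ with $e$ in $\gamma_{u,\alpha}$. For $\alpha\in A\setminus A_0$ with unique edge $e_\alpha$: $F(\alpha)=\gcd(f(\alpha),p(\alpha,e_\alpha))\ge0$; $F(\mathcal{T})=\sum_{\alpha\in A\setminus A_0}F(\alpha)$. $g(\mathcal{T})=\tfrac12(2-M(\mathcal{T})-F(\mathcal{T}))$, $\delta(\mathcal{T})=\tfrac12(F(\mathcal{T})-M(\mathcal{T}))$. A root of $(V,A,E,f,q)$ is a vertex $v_0$ with $q(e,v_0)=1$ for every edge $e\ni v_0$ such that for every $v\in V\setminus\{v_0\}$, all edges $e\ni v$ not in $\gamma_{v_0,v}$ satisfy $q(e,v)\ge1$ and at most one of them satisfies $q(e,v)\ne1$. A decorated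 rooted tree is $(V,A,E,f,q,v_0)$ with $v_0$ a root. $\deg(\mathcal{T})$ denotes $N_{v_0}$. Central elements: for a path $(w_1,\dots,w_m)$, $m\ge2$, say it satisfies $(+)$ if every edge $e\ni w_m$ other than $\{w_{m-1},w_m\}$ has $q(e,w_m)\ge1$ and at most one such edge has $q(e,w_m)>1$. An element $\eta\in V\cup A$ of a decorated tree is central if $\gamma_{\eta,v}$ satisfies $(+)$ for every $v\in V\setminus\{\eta\}$. For a decorated tree $\mathcal{S}=(V,A,E,f,q)$ and central $\eta$, $\mathcal{S}^{(\eta)}$ is the unique decorated tree $(V,A,E,f,q^* )$ (such a unique tree exists) with: $q^*(e,\eta)=q(e,\eta)$ for all $e\ni\eta$; $q^*(e,v)=q(e,v)$ for all $v\in V\setminus\{\eta\}$ and edges $e\ni v$ not in $\gamma_{\eta,v}$; $q^*(e,v)=Q(e,v)-q(e,v)$ for every edge $e=\{\eta,v\}$ with $v\in V$; and $\det^*(e)=-\det(e)$ for every edge $e=\{u,v\}$ with $u,v\in V\setminus\{\eta\}$ ($\det^*$ computed with $q^*$). The trees $\mathcal{T}_i$: let $v_1,\dots,v_n$ be the distinct cells adjacent to $v_0$, $e_i=\{v_0,v_i\}$. Delete $e_1,\dots,e_n$ from $\mathcal{T}$; let $\mathcal{C}_i$ be the connected component containing $v_i$. Let $\mathcal{T}'_i$ be obtained from $\mathcal{C}_i$ by adding an arrow $\alpha_i$ with $f(\alpha_i)=0$ and an edge $\{\alpha_i,v_i\}$ decorated $q(e_i,v_i)$ near $v_i$ and $1$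 near $\alpha_i$. Then $\alpha_i$ is central in $\mathcal{T}'_i$ and $\mathcal{T}_i:=(\mathcal{T}'_i)^{(\alpha_i)}$. *)

(* Defs.v *)
From mathcomp Require Import all_boot all_order all_algebra.
From Stdlib Require Import ClassicalEpsilon.

Set Implicit Arguments.
Unset Strict Implicit.
Unset Printing Implicit Defensive.
Import Order.TTheory GRing.Theory Num.Theory.
Local Open Scope ring_scope.

(* A (candidate) decorated tree on a finite carrier type T:
   vertices dV, arrows dA, edges dE (sets of cells), f and q.
   f is only meaningful on arrows, q e x only for e in dE and x in e. *)
Record dtree (T : finType) := DTree {
  dV : {set T};
  dA : {set T};
  dE : {set {set T}};
  df : T -> int;
  dq : {set T} -> T -> int }.

Section DecoratedTrees.
Variables (T : finType) (D : dtree T).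

Local Notation V := (dV D).
Local Notation A := (dA D).
Local Notation E := (dE D).
Local Notation f := (df D).
Local Notation q := (dq D).

Definition cells : {set T} := V :|: A.

Definition valency (x : T) : nat := #|[set e in E | x \in e]|.

(* A path (x_0, ..., x_n) is represented as x_0 :: s. *)
Definition pedges (x : T) (s : seq T) : seq {set T} :=
  pairmap (fun a b => [set a; b]) x s.

Definition is_path_from (x : T) (s : seq T) : bool :=
  [&& all (fun y => y \in cells) (x :: s),
      all (fun e => e \in E) (pedges x s) & uniq (pedges x s)].

Definition is_graph : Prop :=
  forall e, e \in E -> e \subset cells /\ #|e| = 2%N.

Definition is_tree : Prop :=
  is_graph /\
  forall x y, x \in cells -> y \in cells ->
    exists! s, is_path_from x s /\ last x s = y.

(* gamma_{x,y}: the (unique, for a tree) path from x to y; it is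
   x :: gamma x y. *)
Definition gamma (x y : T) : seq T :=
  epsilon (inhabits [::]) (fun s => is_path_from x s /\ last x s = y).
Definition gcells (x y : T) : seq T := x :: gamma x y.
Definition gedges (x y : T) : seq {set T} := pedges x (gamma x y).

Definition is_decorated_tree : Prop :=
  [/\ [disjoint V & A],
      is_tree,
      (forall a, a \in A -> valency a = 1%N),
      (forall e a, e \in E -> a \in A -> a \in e -> q e a = 1) &
      (forall v e e', v \in V -> e \in E -> e' \in E -> v \in e -> v \in e' ->
         e != e' -> gcdz (q e v) (q e' v) = 1)].

Definition A0 : {set T} := [set a in A | f a == 0].
Definition Anz : {set T} := A :\: A0.

Definition Qc (e : {set T}) (x : T) : int :=
  \prod_(e' in E | (x \in e') && (e' != e)) q e' x.

Definition detx (e : {set T}) (x y : T) : int :=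
  q e x * q e y - Qc e x * Qc e y.

Definition incident (x y : T) (eps : {set T}) : bool :=
  [&& eps \in E, eps \notin gedges x y & has (fun u => u \in eps) (gcells x y)].

(* q(eps, gamma_{x,y}) = q(eps, u) for the cell u of gamma in eps *)
Definition qpath (x y : T) (eps : {set T}) : int :=
  q eps (head x [seq u <- gcells x y | u \in eps]).

Definition xv (v a : T) : int :=
  f a * \prod_(eps in E | incident v a eps) qpath v a eps.
Definition xhat (v a : T) : int :=
  f a * \prod_(eps in E | incident v a eps && (v \notin eps)) qpath v a eps.

Definition Nv (v : T) : int := \sum_(a in Anz) xv v a.

Definition Mt : int := - \sum_(v in V :|: A0) Nv v * ((valency v)%:Z - 2).

Definition pp (u : T) (e : {set T}) : int :=
  \sum_(a in Anz | e \in gedges u a) xhat u a.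

Definition e_of (a : T) : {set T} := odflt set0 [pick e in E | a \in e].

Definition Ff (a : T) : int := gcdz (f a) (pp a (e_of a)).
Definition Ft : int := \sum_(a in Anz) Ff a.

Definition genus : rat := (2 - Mt - Ft)%:~R / 2.
Definition deltaT : rat := (Ft - Mt)%:~R / 2.

Definition is_root (v0 : T) : Prop :=
  [/\ v0 \in V,
      (forall e, e \in E -> v0 \in e -> q e v0 = 1) &
      (forall v, v \in V -> v != v0 ->
         (forall e, e \in E -> v \in e -> e \notin gedges v0 v -> 1 <= q e v) /\
         (#|[set e in E | [&& v \in e, e \notin gedges v0 v & (q e v != 1)%R]]| <= 1)%N)].

Definition degT (v0 : T) : int := Nv v0.

Definition plus_cond (x y : T) : Prop :=
  let lastE := last set0 (gedges x y) in
  (forall e, e \in E -> y \in e -> e != lastE -> 1 <= q e y) /\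
  (#|[set e in E | [&& y \in e, e != lastE & (1 < q e y)%R]]| <= 1)%N.

Definition central (eta : T) : Prop :=
  eta \in cells /\ forall v, v \in V -> v != eta -> plus_cond eta v.

End DecoratedTrees.

Definition is_transform (T : finType) (S : dtree T) (eta : T)
    (qs : {set T} -> T -> int) : Prop :=
  let S' := DTree (dV S) (dA S) (dE S) (df S) qs in
  [/\ is_decorated_tree S',
      (forall e, e \in dE S -> eta \in e -> qs e eta = dq S e eta),
      (forall v e, v \in dV S -> v != eta -> e \in dE S -> v \in e ->
          e \notin gedges S eta v -> qs e v = dq S e v),
      (forall v, v \in dV S -> [set eta; v] \in dE S ->
          qs [set eta; v] v = Qc S [set eta; v] v - dq S [set eta; v] v) &
      (forall u v, u \in dV S -> v \in dV S -> u != eta -> v != eta ->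
          [set u; v] \in dE S ->
          detx S' [set u; v] u v = - detx S [set u; v] u v)].

Section Subtrees.
Variables (T : finType) (D : dtree T) (v0 : T).

Definition nbrs : {set T} := [set u | [set v0; u] \in dE D].

Definition redrel : rel T :=
  fun x y => ([set x; y] \in dE D) && (v0 \notin [set x; y]).

Definition comp (u : T) : {set T} := [set w | connect redrel u w].

(* T'_u on carrier option T: Some x for cells of C_u, None for alpha_u *)
Definition Tprime (u : T) : dtree (option T) :=
  let C := comp u in
  let enew : {set option T} := [set None; Some u] in
  DTree (Some @: (dV D :&: C))
        (None |: Some @: (dA D :&: C))
        (enew |: [set (Some @: e : {set option T}) | e : {set T} in [set e0 in dE D | e0 \subset C]])
        (fun x => if x is Some y then df D y else 0)
        (fun e x =>
           if e == enew then (if x is Some y then dq D [set v0; u] y else 1)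
           else if x is Some y then dq D [set z | Some z \in e] y else 0).

(* T_u = (T'_u)^(alpha_u), with the decoration qs given *)
Definition Tsub (u : T) (qs : {set option T} -> option T -> int) : dtree (option T) :=
  DTree (dV (Tprime u)) (dA (Tprime u)) (dE (Tprime u)) (df (Tprime u)) qs.

End Subtrees.

(* Main.v *)
(* For a non-root cell v write m v for the product of the decorations incident
   to the path from v to v0.  The determinant relations defining T_u say that the
   two decorations of v on the side of the root, before and after the transform,
   add up to a product of decorations incident to that path; hence
   x_{v,a} computed in T plus x_{v,a} computed in T_u equals m v * x_{v0,a} for
   v and a in the same branch, whereas x_{v,a} = m v * x_{v0,a} when the branches
   differ.  So N_v in T_u is m v * d - N_v, and the theorem reduces to
   sum_{v <> v0} m v * (delta_v - 2) = - delta_{v0}, which telescopes from parents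
   to children because at most one decoration below each vertex differs from 1. *)
Require Import Defs.
From mathcomp Require Import all_boot all_order all_algebra.
From mathcomp Require Import ring zify.
From Stdlib Require Import ClassicalEpsilon.
Set Implicit Arguments.
Unset Strict Implicit.
Unset Printing Implicit Defensive.
Import GRing.Theory Num.Theory.
Local Open Scope ring_scope.

(** The transform is prescribed edge by edge, and each determinant relation mixes decorations at
    both ends of an edge. The comparisons of path products therefore go by induction on the distance
    to the root, from a cell to its parent. Moving the start of a path by one edge would divide by
    the decoration of that edge, so the recursion is kept in multiplied form and cancelled; this is
    legitimate because a decoration pointing away from the root is 1 at v0 and at least 1 elsewhere.
    The trees T_u live on another carrier than T. Their decorations are pulled back to one function
    on pairs of neighbours of T, so that before and after become two weights on the same tree. The
    assumption on f enters twice: F only counts the arrows with f = 1, and for these arrows x_{v0,a}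
    = m a. Hence the telescoping sum over all non-root cells and the sum over V and A0 that occurs
    in M differ by exactly d. *)

Section PathWeights.
Variables (T : finType) (nb : T -> {set T}) (g : T -> T -> int).

Definition wprod (w : T) (X : seq T) : int := \prod_(y in nb w | y \notin X) g w y.

(* Products over the edges incident to the path x :: s, where g w y stands for
   q({w, y}, w) and nb w for the neighbours of w: path_weight is x_{v,a} / f(a),
   and hat_weight, which omits the edges at x, is \hat x_{v,a} / f(a). *)
Fixpoint hat_weight (x : T) (s : seq T) : int :=
  if s is w :: s' then wprod w (x :: take 1 s') * hat_weight w s' else 1.

Definition path_weight (x : T) (s : seq T) : int :=
  wprod x (take 1 s) * hat_weight x s.

Lemma wprodD1 w z X : z \in nb w -> z \notin X ->
  wprod w X = g w z * wprod w (z :: X).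
Proof.
move=> zw zX; rewrite /wprod (bigD1 z) ?zw //=; congr (_ * _).
by apply: eq_bigl => y; rewrite inE negb_or -andbA [(y \notin X) && _]andbC.
Qed.

(** When the start moves from x to w, the edges at x other than {x, w} stop being incident and {w,
    x} becomes incident. The identity is multiplied out so that no division occurs. *)
Lemma path_weight_cons x w s : x \in nb w -> x \notin s ->
  g w x * path_weight x (w :: s) = wprod x [:: w] * path_weight w s.
Proof.
move=> xw xs; rewrite /path_weight /= take0 (@wprodD1 w x (take 1 s)) //; first ring.
by apply: contra xs; apply: mem_take.
Qed.

End PathWeights.

(** If c0 carries the exceptional value, its own summand is 1 and every other summand is the full
    product; without an exception all summands are 1. For empty [S] both sides are 0, which is the
    case of a leaf. *)
Lemma sum_prod_others (I : finType) (S : {set I}) (h : I -> int) :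
  (#|[set y in S | h y != 1]| <= 1)%N ->
  \sum_(c in S) \prod_(y in S | y != c) h y = (#|S|%:Z - 1) * \prod_(y in S) h y + 1.
Proof.
move=> h1; case: (pickP [pred y in S | h y != 1]) => [c0 /= /andP[c0S hc0]|h0].
  have oth y : y \in S -> y != c0 -> h y = 1.
    move=> yS yc; apply/eqP/negPn/negP => hy; move: h1; apply/negP; rewrite -ltnNge.
    apply: (@leq_trans #|[set y; c0]|); first by rewrite cards2 yc.
    by apply/subset_leq_card/subsetP => z; rewrite !inE => /orP[]/eqP->; rewrite ?yS ?c0S.
  have pS : \prod_(y in S) h y = h c0.
    by rewrite (bigD1 c0) //= big1 ?mulr1 // => y /andP[]; apply: oth.
  rewrite (bigD1 c0) //= big1; last by move=> y /andP[]; apply: oth.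
  rewrite (eq_bigr (fun=> h c0)); last first.
    move=> c /andP[cS cc0]; rewrite (bigD1 c0) /=; last by rewrite c0S eq_sym.
    by rewrite big1 ?mulr1 // => y /andP[/andP[]] yS _; apply: oth.
  rewrite pS sumr_const (cardsD1 c0 S) c0S.
  rewrite (_ : #|_| = #|S :\ c0|); last by apply: eq_card => y; rewrite !inE unfold_in andbC.
  by rewrite -mulr_natl natz; lia.
have oth y : y \in S -> h y = 1.
  by move=> yS; move: (h0 y); rewrite /= yS /= => /negbFE/eqP.
have ones c : c \in S -> \prod_(y in S | y != c) h y = 1.
  by move=> _; apply: big1 => y /andP[/oth].
by rewrite (eq_bigr _ ones) (eq_bigr _ oth) prodr_const expr1n sumr_const natz; lia.
Qed.

(** * Paths in a tree, and path products read through neighbours *)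

Section Trees.
Variables (T : finType) (D : dtree T).
Hypothesis treeD : is_tree D.

Local Notation C := (cells D).
Local Notation nb := (nbrs D).
Local Notation ga := (gamma D).
Local Notation adj := (fun x y => [set x; y] \in dE D).

Definition edge_weight (w y : T) : int := dq D [set w; y] w.

Lemma in_nbrs x y : (y \in nb x) = ([set x; y] \in dE D).
Proof. by rewrite inE. Qed.

Lemma nbrs_sym x y : (y \in nb x) = (x \in nb y).
Proof. by rewrite !inE setUC. Qed.

Lemma nbrs_neq x y : y \in nb x -> y != x.
Proof.
rewrite inE => /(treeD.1 _)[_]; apply: contra_eqN => /eqP->.
by rewrite setUid cards1.
Qed.

Lemma nbrs_cells x y : y \in nb x -> y \in C.
Proof. by rewrite inE => /(treeD.1 _)[/subsetP s _]; apply: s; rewrite !inE eqxx orbT. Qed.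

Lemma mem_pedges (x : T) s e z : e \in pedges x s -> z \in e -> z \in x :: s.
Proof.
elim: s x => //= y s IH x; rewrite inE => /orP[/eqP->|/IH {}IH /IH zs].
  by rewrite !inE => /orP[]/eqP->; rewrite eqxx ?orbT.
by rewrite inE zs orbT.
Qed.

Lemma pedges_cat (x : T) s1 s2 : pedges x (s1 ++ s2) = pedges x s1 ++ pedges (last x s1) s2.
Proof. exact: pairmap_cat. Qed.

Lemma is_path_from_adj x s : is_path_from D x s -> path adj x s.
Proof.
case/and3P=> _ + _; elim: s x => //= y s IH x /andP[-> /=]; apply: IH.
Qed.

Lemma adj_is_path_from x s : x \in C -> path adj x s -> uniq (x :: s) -> is_path_from D x s.
Proof.
elim: s x => [|y s IH] x xC; first by rewrite /is_path_from /= xC.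
move=> /= /andP[xy ps] /and3P[xs ys us].
have yC : y \in C by apply: (@nbrs_cells x); rewrite inE.
have us' : uniq (y :: s) by rewrite /= ys.
have /and3P[p1 p2 p3] := IH _ yC ps us'.
apply/and3P; split; rewrite ?cons_uniq //=.
- by move: p1 => /= ->; rewrite xC.
- by rewrite xy.
- rewrite p3 andbT; apply: contra xs => /mem_pedges; apply.
  by rewrite !inE eqxx.
Qed.

Lemma is_path_from_prefix x s1 s2 : is_path_from D x (s1 ++ s2) -> is_path_from D x s1.
Proof.
rewrite /is_path_from -cat_cons all_cat pedges_cat all_cat cat_uniq.
by case/and3P=> /andP[-> _] /andP[-> _] /andP[-> _].
Qed.

Lemma is_path_from_behead x y s : is_path_from D x (y :: s) -> is_path_from D y s.
Proof. by case/and3P=> /= /and3P[_ a b] /andP[_ c] /andP[_ d]; apply/and3P; split=> //=; rewrite a. Qed.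

Lemma gamma_spec x y : x \in C -> y \in C -> is_path_from D x (ga x y) /\ last x (ga x y) = y.
Proof.
move=> xC yC; apply: (epsilon_spec (inhabits [::]) (fun s => is_path_from D x s /\ last x s = y)).
by have [s [ps _]] := treeD.2 _ _ xC yC; exists s.
Qed.

Lemma is_path_from_eq x s : is_path_from D x s -> s = ga x (last x s).
Proof.
move=> ps; have /allP sC : all (fun y => y \in C) (x :: s) by case/and3P: ps.
have xC : x \in C by rewrite sC ?mem_head.
have lC : last x s \in C by rewrite sC ?mem_last.
have [t [_ ut]] := treeD.2 _ _ xC lC.
by transitivity t; [apply/esym/ut | apply/ut/gamma_spec].
Qed.

Lemma gammaxx x : x \in C -> ga x x = [::].
Proof.
move=> xC; apply/esym; apply: (@is_path_from_eq x [::]).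
by rewrite /is_path_from /= xC.
Qed.

(** Paths are only required to have distinct edges. A repeated cell would cut out a nonempty path
    from that cell to itself, while the empty path is the only one. *)
Lemma is_path_from_uniq x s : is_path_from D x s -> uniq (x :: s).
Proof.
elim: s x => //= y s IH x ps.
have /= -> := IH _ (is_path_from_behead ps); rewrite andbT.
apply/negP => xs; have xC : x \in C by case/and3P: ps => /andP[].
case/splitPr: xs ps => s1 s2; rewrite -cat_rcons => /is_path_from_prefix /is_path_from_eq.
by rewrite last_rcons gammaxx //; case: s1.
Qed.

Lemma gamma_path x y : x \in C -> y \in C -> path adj x (ga x y).
Proof. by move=> xC yC; apply: is_path_from_adj; case: (gamma_spec xC yC). Qed.

Lemma gamma_last x y : x \in C -> y \in C -> last x (ga x y) = y.
Proof. by move=> xC yC; case: (gamma_spec xC yC). Qed.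

Lemma gamma_uniq x y : x \in C -> y \in C -> uniq (x :: ga x y).
Proof. by move=> xC yC; apply: is_path_from_uniq; case: (gamma_spec xC yC). Qed.

Lemma path_gamma x s : x \in C -> path adj x s -> uniq (x :: s) -> ga x (last x s) = s.
Proof. by move=> xC ps us; rewrite -is_path_from_eq //; apply: adj_is_path_from. Qed.

Lemma gamma_consE x y w s : x \in C -> y \in C -> ga x y = w :: s ->
  w \in nb x /\ s = ga w y.
Proof.
move=> xC yC e; have [p l] := gamma_spec xC yC; rewrite e in p l.
split; first by have := is_path_from_adj p; rewrite inE => /= /andP[].
by rewrite -[y in RHS]l /=; apply/is_path_from_eq/(is_path_from_behead p).
Qed.

Lemma gamma_edge x y : y \in nb x -> ga x y = [:: y].
Proof.
move=> xy; rewrite -[y in LHS]/(last x [:: y]) path_gamma //.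
- by apply: (@nbrs_cells y); rewrite nbrs_sym.
- by rewrite /= -in_nbrs xy.
- by rewrite /= !inE eq_sym nbrs_neq.
Qed.

Lemma gamma_neq x y : x \in C -> y \in C -> x != y ->
  exists2 w, w \in nb x & ga x y = w :: ga w y.
Proof.
move=> xC yC xy; case e: (ga x y) => [|w s].
  by have := gamma_last xC yC; rewrite e /= => /eqP; rewrite (negPf xy).
by have [wx ->] := gamma_consE xC yC e; exists w.
Qed.

Lemma gamma_nbr_head x y w : x \in C -> y \in C -> w \in nb x -> w \in ga x y ->
  ga x y = w :: ga w y.
Proof.
move=> xC yC wx wg; have [p l] := gamma_spec xC yC.
case: (splitPr wg) p l => s1 s2 p l.
have := p; rewrite -cat_rcons => /is_path_from_prefix /is_path_from_eq.
rewrite last_rcons gamma_edge //; case: s1 p l => [|z [|? ?]] //= p l _.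
by rewrite -l -(is_path_from_eq (is_path_from_behead p)).
Qed.

(** If x lies on the path from w to y, that path starts with the edge to x; if not, the edge can be
    prefixed to it. *)
Lemma gamma_dichotomy x w y : y \in C -> w \in nb x ->
  ga x y = w :: ga w y \/ ga w y = x :: ga x y.
Proof.
move=> yC wx; have wC := nbrs_cells wx.
have xw : x \in nb w by rewrite nbrs_sym.
have xC := nbrs_cells xw.
case: (boolP (x \in ga w y)) => [xg|xg]; [right; exact: gamma_nbr_head|left].
rewrite -[y in LHS](gamma_last wC yC) -[last w _]/(last x (w :: ga w y)) path_gamma //.
  by rewrite /= gamma_path // -in_nbrs wx.
by rewrite cons_uniq gamma_uniq // inE negb_or xg eq_sym nbrs_neq.
Qed.

Lemma gamma_consN x y w : x \in C -> y \in C -> ga x y = w :: ga w y -> x \notin ga w y.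
Proof.
by move=> xC yC e; have := gamma_uniq xC yC; rewrite e /= inE negb_or => /andP[/andP[]].
Qed.

Lemma pedges_rev (x : T) s : pedges (last x s) (behead (rev (x :: s))) = rev (pedges x s).
Proof.
elim: s x => [|y s IH] x //=; rewrite !rev_cons -IH.
case/lastP: s {IH} => [|s z]; first by rewrite /= setUC.
rewrite last_rcons rev_cons rev_rcons /= -[rcons (rcons _ _) x]cats1 pedges_cat /=.
by rewrite last_rcons setUC cats1.
Qed.

(** The root condition speaks of paths leaving the root, whereas the inductions follow paths towards
    it. *)
Lemma gedges_rev x y : x \in C -> y \in C -> gedges D y x = rev (gedges D x y).
Proof.
move=> xC yC; have [p l] := gamma_spec xC yC.
rewrite {1}/gedges; suff -> : ga y x = behead (rev (x :: ga x y)).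
  by rewrite -[y in pedges y]l pedges_rev.
move: (ga x y) p l => s p l.
have yr : rev (x :: s) = y :: behead (rev (x :: s)).
  by case/lastP: s l {p} => [|s z]; rewrite ?last_rcons -?rcons_cons ?rev_rcons //= => ->.
have lx : last y (behead (rev (x :: s))) = x.
  by rewrite -[LHS]/(last x (y :: behead _)) -yr rev_cons last_rcons.
rewrite -[x in LHS]lx; apply/esym/is_path_from_eq.
case/and3P: p => p1 p2 p3; apply/and3P; split.
- by rewrite -yr all_rev.
- by rewrite -[y in pedges y]l pedges_rev all_rev.
- by rewrite -[y in pedges y]l pedges_rev rev_uniq.
Qed.

(** By uniqueness, the segment of the path between two adjacent cells is their edge itself. It
    follows that an edge outside a path meets it in at most one cell. *)
Lemma path_chord x s y z : is_path_from D x s -> y \in x :: s -> z \in x :: s ->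
  z \in nb y -> [set y; z] \in pedges x s.
Proof.
have key w t c : is_path_from D w t -> c \in t -> c \in nb w -> [set w; c] \in pedges w t.
  move=> p ct cw; case/splitPr: ct p => s1 s2; rewrite -cat_rcons => /is_path_from_prefix.
  move/is_path_from_eq; rewrite last_rcons gamma_edge //.
  by case: s1 => [|? [|? ?]] //= _; rewrite inE eqxx.
elim: s x => [|w s IH] x p.
  by rewrite !mem_seq1 => /eqP-> /eqP-> /nbrs_neq; rewrite eqxx.
rewrite inE => /orP[/eqP->|ys]; rewrite inE => /orP[/eqP->|zs] zy.
- by move/nbrs_neq: zy; rewrite eqxx.
- exact: key.
- by rewrite setUC; apply: key => //; rewrite nbrs_sym.
- by rewrite /= inE IH ?orbT //; apply: is_path_from_behead p.
Qed.

Lemma edges_nbrs x (P : pred {set T}) (F : {set T} -> int) :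
  \prod_(e in dE D | (x \in e) && P e) F e = \prod_(y in nb x | P [set x; y]) F [set x; y].
Proof.
have inj : {in nb x &, injective (fun y => [set x; y])}.
  move=> y z yx zx /setP /(_ y); rewrite !inE eqxx orbT (negPf (nbrs_neq yx)) /=.
  by move/esym/eqP.
have im : [set e in dE D | x \in e] = [set [set x; y] | y in nb x].
  apply/setP=> e; rewrite inE; apply/andP/imsetP => [[eE xe]|[y yx ->]]; last first.
    by rewrite -in_nbrs yx !inE eqxx.
  have /eqP/cards2P[a [b [ab eab]]] := (treeD.1 _ eE).2.
  move: xe eE; rewrite eab in_set2 => /orP[]/eqP-> abE; [exists b|exists a] => //.
  - by rewrite inE.
  - by rewrite inE setUC.
  - by rewrite setUC.
transitivity (\prod_(e in [set [set x; y] | y in nb x] | P e) F e).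
  by apply: eq_bigl => e; rewrite -im inE andbA.
rewrite big_mkcondr big_imset //= -big_mkcondr //.
Qed.

Lemma valency_nbrs x : valency D x = #|nb x|.
Proof.
(* With the constant factor 2, the product identity reads as an equality of powers of 2, whose
   exponents are the two cardinals. *)
rewrite /valency; have := @edges_nbrs x predT (fun=> 2).
under eq_bigl do rewrite andbT; under [in RHS]eq_bigl do rewrite andbT.
rewrite !prodr_const => /(congr1 (fun z : int => `|z|%N)).
rewrite !abszX => /eqP; rewrite eqn_exp2l // => /eqP <-.
by apply: eq_card => e; rewrite !inE.
Qed.

Lemma Qc_wprod x y : y \in nb x -> Qc D [set x; y] x = wprod nb edge_weight x [:: y].
Proof.
move=> yx; rewrite /Qc edges_nbrs; apply: eq_bigl => z.
rewrite mem_seq1; case: (boolP (z \in nb x)) => //= zx; congr negb; apply/eqP/eqP => [|->//].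
by move/setP/(_ z); rewrite !inE eqxx orbT (negPf (nbrs_neq zx)) /= => /esym/eqP.
Qed.

Lemma hat_weightE x s : is_path_from D x s ->
  \prod_(u <- s) \prod_(e in dE D | (u \in e) && (e \notin pedges x s)) dq D e u
  = hat_weight nb edge_weight x s.
Proof.
elim: s x => [|w s IH] x p; first by rewrite big_nil.
have pw := is_path_from_behead p.
have u1 := is_path_from_uniq p; have u2 := is_path_from_uniq pw.
rewrite big_cons /= -IH //; congr (_ * _).
  rewrite edges_nbrs; apply: eq_bigl => y; case: (boolP (y \in nb w)) => //= yw.
  have eq2 c : ([set w; y] == [set w; c]) = (y == c).
    apply/eqP/eqP => [|->//]; move/setP/(_ y).
    by rewrite !inE eqxx orbT (negPf (nbrs_neq yw)) /= => /esym/eqP.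
  rewrite inE (setUC [set x]) eq2; congr (~~ (_ || _)).
  case: s {IH p u1} pw u2 => //= z s _; rewrite take0 !inE eq2 => /and3P[ws _ _].
  congr (_ || _); apply/negP => /mem_pedges h.
  by move: ws; rewrite -in_cons h // !inE eqxx.
rewrite big_seq [in RHS]big_seq; apply: eq_bigr => u us; apply: eq_bigl => e.
case: (boolP (u \in e)) => //= ue; rewrite inE negb_or.
suff -> : e != [set x; w] by [].
apply: contraTneq ue => ->; rewrite !inE negb_or.
move: u1; rewrite /= => /and3P[xs ws _].
rewrite (contraNneq _ xs) /=; last by move=> <-; rewrite inE us orbT.
by rewrite (contraNneq _ ws) // => <-.
Qed.

Lemma path_weightE x s : is_path_from D x s ->
  \prod_(u <- x :: s) \prod_(e in dE D | (u \in e) && (e \notin pedges x s)) dq D e u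
  = path_weight nb edge_weight x s.
Proof.
move=> p; rewrite big_cons hat_weightE //; congr (_ * _).
rewrite edges_nbrs; apply: eq_bigl => y; case: (boolP (y \in nb x)) => //= yx.
have u1 := is_path_from_uniq p.
case: s p u1 => //= z s _ /andP[xs _]; rewrite take0 !inE; congr negb.
have -> : ([set x; y] == [set x; z]) = (y == z).
  apply/eqP/eqP => [|->//]; move/setP/(_ y).
  by rewrite !inE eqxx orbT (negPf (nbrs_neq yx)) /= => /esym/eqP.
rewrite orb_idr // => /mem_pedges h.
by move: xs; rewrite h // !inE eqxx.
Qed.

(** The product over incident edges is exchanged into a product over path cells and then over edges
    at each cell. No edge is counted twice, since one containing two cells of the path would belong
    to it; hence also the [head] in [qpath] selects the only candidate. *)
Lemma xvE v a : v \in C -> a \in C ->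
  xv D v a = df D a * path_weight nb edge_weight v (ga v a).
Proof.
move=> vC aC; rewrite /xv; congr (_ * _); have [p _] := gamma_spec vC aC.
rewrite -path_weightE // (exchange_big_dep (fun e => (e \in dE D) && (e \notin gedges D v a))) /=; last first.
  by move=> u e _ /and3P[-> _ ->].
rewrite [LHS]big_mkcond [RHS]big_mkcond; apply: eq_bigr => e _.
rewrite /incident; case: (boolP (e \in dE D)) => //= eE.
case: (boolP (e \in gedges D v a)) => //= eg.
under eq_bigl do rewrite andbT.
rewrite -[_ || _]/(has (fun u => u \in e) (gcells D v a)).
rewrite -[RHS]big_filter /qpath has_filter.
suff : (size [seq u <- gcells D v a | u \in e] <= 1)%N.
  rewrite -/(gcells D v a); case: [seq u <- gcells D v a | u \in e] => [|c [|//]] _ /=.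
    by rewrite big_nil.
  by rewrite big_seq1.
have ug := filter_uniq (fun u => u \in e) (is_path_from_uniq p).
case E : [seq u <- gcells D v a | u \in e] ug => [|c [|b t]] //=.
rewrite inE negb_or => /andP[/andP[cb _] _].
have [ci ce] : c \in gcells D v a /\ c \in e.
  apply/andP; rewrite andbC -(mem_filter (fun u => u \in e)).
  by rewrite E inE eqxx.
have [bi be] : b \in gcells D v a /\ b \in e.
  apply/andP; rewrite andbC -(mem_filter (fun u => u \in e)).
  by rewrite E !inE eqxx orbT.
have ee : e = [set c; b].
  apply/esym/eqP; rewrite eqEcard (treeD.1 _ eE).2 cards2 cb andbT.
  by apply/subsetP => y; rewrite !inE => /orP[]/eqP->.
case/negP: eg; rewrite ee; apply: path_chord => //.
by rewrite inE -ee.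
Qed.

Lemma gedges_away v0 v w y : v0 \in C -> v \in C -> ga v v0 = w :: ga w v0 ->
  y \in nb v -> y != w -> [set v; y] \notin gedges D v0 v.
Proof.
move=> v0C vC e yv yw; rewrite gedges_rev // mem_rev /gedges e /= inE negb_or.
have vN := gamma_consN vC v0C e.
have [wv _] := gamma_consE vC v0C e.
apply/andP; split.
  apply/eqP => /setP/(_ y); rewrite !inE eqxx orbT (negPf (nbrs_neq yv)) (negPf yw).
  by [].
apply/negP => /mem_pedges /(_ (set21 v y)).
by rewrite inE (negPf vN) orbF eq_sym (negPf (nbrs_neq wv)).
Qed.

End Trees.

(** * Parents, branches and descendants with respect to a root *)

Section RootedTrees.
Variables (T : finType) (D : dtree T) (v0 : T).
Hypothesis treeD : is_tree D.
Hypothesis v0C : v0 \in cells D.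

Local Notation C := (cells D).
Local Notation nb := (nbrs D).
Local Notation ga := (gamma D).
Local Notation adj := (fun x y => [set x; y] \in dE D).

Definition parent (v : T) : T := head v0 (ga v v0).
Definition branch (v : T) : T := head v0 (ga v0 v).
(** Descendants of v, v included, in a form that rewrites directly inside [hat_weight]. *)
Definition below (v a : T) : bool := ga (parent v) a == v :: ga v a.

Lemma gamma_parent v : v \in C -> v != v0 -> ga v v0 = parent v :: ga (parent v) v0.
Proof. by move=> vC vv0; rewrite /parent; have [w _ ->] := gamma_neq treeD vC v0C vv0. Qed.

Lemma parent_nbrs v : v \in C -> v != v0 -> parent v \in nb v.
Proof. by move=> vC vv0; case: (gamma_consE treeD vC v0C (gamma_parent vC vv0)). Qed.

Lemma parent_cells v : v \in C -> v != v0 -> parent v \in C.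
Proof. by move=> vC vv0; apply: nbrs_cells (parent_nbrs vC vv0). Qed.

Lemma nbrs_parent v : v \in C -> v != v0 -> v \in nb (parent v).
Proof. by move=> vC vv0; rewrite nbrs_sym parent_nbrs. Qed.

Lemma gamma_branch v : v \in C -> v != v0 -> ga v0 v = branch v :: ga (branch v) v.
Proof.
move=> vC vv0; rewrite /branch; rewrite eq_sym in vv0.
by have [w _ ->] := gamma_neq treeD v0C vC vv0.
Qed.

Lemma branch_nbrs v : v \in C -> v != v0 -> branch v \in nb v0.
Proof. by move=> vC vv0; case: (gamma_consE treeD v0C vC (gamma_branch vC vv0)). Qed.

(** Induction on the distance to the root. Children of the root form a separate base case because
    the transform prescribes their decorations by a different rule. *)
Lemma rooted_ind (P : T -> Prop) :
    (forall v, v \in C -> v != v0 -> parent v = v0 -> P v) ->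
    (forall v, v \in C -> v != v0 -> parent v != v0 -> P (parent v) -> P v) ->
  forall v, v \in C -> v != v0 -> P v.
Proof.
move=> P0 PS v; have [n] := ubnP (size (ga v v0)).
elim: n v => // n IH v sz vC vv0; case: (eqVneq (parent v) v0) => [|pv]; first exact: P0.
apply: PS => //; apply: IH => //; last exact: parent_cells.
by move: sz; rewrite (gamma_parent vC vv0).
Qed.

Lemma parent_child v c : v \in C -> v != v0 -> c \in nb v -> c != parent v ->
  c != v0 /\ parent c = v.
Proof.
move=> vC vv0 cv cp; have cv0 : c != v0.
  by apply: contraNneq cp => ec; rewrite /parent gamma_edge -?ec // eqxx.
split=> //; rewrite /parent; case: (gamma_dichotomy treeD v0C cv) => [e|->//].
by move: cp; rewrite /parent e /= eqxx.
Qed.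

Lemma parent_root_child c : c \in nb v0 -> parent c = v0.
Proof. by move=> cv; rewrite /parent gamma_edge // nbrs_sym. Qed.

Lemma grandparent_neq v : v \in C -> v != v0 -> parent v != v0 -> parent (parent v) != v.
Proof.
move=> vC vv0 pv; have := gamma_consN treeD vC v0C (gamma_parent vC vv0).
rewrite gamma_parent ?parent_cells // inE negb_or eq_sym.
by case/andP.
Qed.

Lemma belowxx v : v \in C -> v != v0 -> below v v.
Proof. by move=> vC vv0; rewrite /below gammaxx // gamma_edge // nbrs_parent. Qed.

Lemma belowN v a : v \in C -> v != v0 -> a \in C -> ~~ below v a ->
  ga v a = parent v :: ga (parent v) a.
Proof.
move=> vC vv0 aC; rewrite /below.
by case: (gamma_dichotomy treeD aC (parent_nbrs vC vv0)) => // ->; rewrite eqxx.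
Qed.

Lemma below_parent v a : v \in C -> v != v0 -> a \in C -> parent v != v0 ->
  below v a -> below (parent v) a.
Proof.
move=> vC vv0 aC pv /eqP bva; apply/negPn/negP => /belowN.
rewrite parent_cells // => /(_ isT pv aC); rewrite bva => -[e _].
by have := grandparent_neq vC vv0 pv; rewrite -e eqxx.
Qed.

Lemma below_branch v a : v \in C -> v != v0 -> a \in C -> below v a -> branch a = branch v.
Proof.
move=> + + aC; move: v; suff br v : v \in C -> v != v0 ->
    (forall b, b \in C -> below v b -> branch b = branch v).
  by move=> v vC vv0; apply: br.
apply: (rooted_ind (P := fun v => forall b, b \in C -> below v b -> branch b = branch v)) => {}v vC vv0 pv.
  have bv b : below v b -> branch b = v by rewrite /below pv /branch => /eqP->.
  by move=> b _ /bv->; rewrite bv // belowxx.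
move=> IH b bC bvb; rewrite (IH b) ?below_parent // (IH v) //.
by apply: below_parent => //; apply: belowxx.
Qed.

Lemma branch_parent v : v \in C -> v != v0 -> parent v != v0 -> branch (parent v) = branch v.
Proof.
move=> vC vv0 pv; apply/esym/below_branch => //; first exact: parent_cells.
by apply: below_parent => //; apply: belowxx.
Qed.

Lemma branch_root_child c : c \in nb v0 -> branch c = c.
Proof. by move=> cv; rewrite /branch gamma_edge. Qed.

(** A walk from u avoiding v0, shortened and prefixed by v0, is the path from v0, so u is its first
    step; conversely that path without its first cell never returns to v0. *)
Lemma comp_branch u v : u \in nb v0 ->
  (v \in Defs.comp D v0 u) = [&& v \in C, v != v0 & branch v == u].
Proof.
move=> uv0; have uC := nbrs_cells treeD uv0.
have uN := nbrs_neq treeD uv0.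
rewrite inE; apply/idP/and3P => [|[vC vv0 /eqP bv]].
  case/connectP => s0 ps0 ->; case/shortenP: ps0 => s ps us _ {s0}.
  have v0s : v0 \notin u :: s.
    elim: s u {us uC} uN ps {uv0} => [|y s IH] u uN /=; first by rewrite inE eq_sym.
    rewrite inE negb_or eq_sym uN => /andP[/andP[_ uy] ps]; apply: IH => //.
    by move: uy; rewrite !inE negb_or eq_sym => /andP[_]; rewrite eq_sym.
  have ps' : path adj u s by apply: sub_path ps => x y /andP[].
  have lC : last u s \in C.
    have /and3P[/allP sC _ _] := adj_is_path_from treeD uC ps' us.
    by rewrite sC ?mem_last.
  split=> //; first by apply: contraNneq v0s => <-; rewrite mem_last.
  rewrite /branch -[last u s]/(last v0 (u :: s)) path_gamma //.
    by rewrite /= ps' -in_nbrs uv0.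
  by rewrite cons_uniq v0s.
have e := gamma_branch vC vv0; rewrite bv in e.
have := gamma_uniq treeD v0C vC; rewrite e cons_uniq => /andP[v0N _].
apply/connectP; exists (ga u v); last by rewrite gamma_last.
have : path adj u (ga u v) by apply: gamma_path.
move: (ga u v) v0N => s; clear - s; elim: s u => //= y s IH u; rewrite !inE !negb_or.
case/and3P=> v0u v0y v0s /andP[uy ps]; rewrite IH // ?inE ?negb_or ?v0y //.
by rewrite /redrel uy !inE negb_or v0u v0y.
Qed.

(** * Identities for a single system of decorations *)

Section OneWeight.
Variable g : T -> T -> int.
Local Notation wp := (wprod nb g).
Local Notation hat x y := (hat_weight nb g x (ga x y)).
Local Notation pw x y := (path_weight nb g x (ga x y)).

Lemma path_weight_root v : v \in C -> v != v0 -> pw v v0 = wp v [:: parent v] * hat v v0.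
Proof. by move=> vC vv0; rewrite /path_weight {1}gamma_parent //= take0. Qed.

Lemma hat_child v c : v \in C -> v != v0 -> c \in nb v -> c != parent v ->
  hat c v0 = wp v [:: c; parent v] * hat v v0.
Proof.
move=> vC vv0 cv cp; have [cv0 pc] := parent_child vC vv0 cv cp.
rewrite (gamma_parent (nbrs_cells treeD cv) cv0) pc /=; congr (_ * _).
by rewrite gamma_parent //= take0.
Qed.

Lemma path_weight_step x y w : x \in C -> y \in C -> ga x y = w :: ga w y ->
  g w x * pw x y = wp x [:: w] * pw w y.
Proof.
move=> xC yC e; rewrite e path_weight_cons //; last exact: gamma_consN e.
by rewrite nbrs_sym; case: (gamma_consE treeD xC yC e).
Qed.

Lemma path_below v a : v \in C -> v != v0 -> a \in C -> v != a -> below v a ->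
  pw v a = g v (parent v) * hat (parent v) a.
Proof.
move=> vC vv0 aC va /eqP bva; rewrite bva /=.
have := gamma_consN treeD (parent_cells vC vv0) aC bva.
have [z zv ->] := gamma_neq treeD vC aC va.
rewrite inE negb_or => /andP[pz _].
by rewrite /path_weight /= take0 (@wprodD1 _ _ _ v (parent v)) ?mulrA ?mem_seq1 ?parent_nbrs.
Qed.

Hypothesis g_root : forall y, y \in nb v0 -> g v0 y = 1.

Lemma wprod_root X : wp v0 X = 1.
Proof. by apply: big1 => y /andP[/g_root]. Qed.

Lemma hat_root_child c : c \in nb v0 -> hat c v0 = 1.
Proof. by move=> cv; rewrite gamma_edge //= ?wprod_root ?mulr1 // nbrs_sym. Qed.

Lemma path_weight_from_root a : pw v0 a = hat v0 a.
Proof. by rewrite /path_weight wprod_root mul1r. Qed.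

(** The path from v0 to a is cut at the edge between v and its parent: the cells strictly between v0
    and v give the first factor, those from v to a the second. Read from v, the first factor also
    includes v0, whose decorations are 1. *)
Lemma hat_below v a : v \in C -> v != v0 -> a \in C -> below v a ->
  hat v0 a = hat v v0 * hat (parent v) a.
Proof.
move=> + + aC; move: v.
suff br v : v \in C -> v != v0 -> (below v a -> hat v0 a = hat v v0 * hat (parent v) a).
  by move=> v vC vv0; apply: br.
apply: (rooted_ind (P := fun v => below v a -> hat v0 a = hat v v0 * hat (parent v) a)) => {}v vC vv0 pv.
  by move=> _; rewrite hat_root_child ?mul1r -?pv ?nbrs_parent.
move=> IH bva; have bpa := below_parent vC vv0 aC pv bva.
have pC := parent_cells vC vv0.
rewrite IH // (@hat_child (parent v) v) ?nbrs_parent //; last by rewrite eq_sym grandparent_neq.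
rewrite (eqP bpa) /= (eqP bva) /= take0 (_ : wp _ [:: v; _] = wp (parent v) [:: parent (parent v); v]).
  by ring.
by apply: eq_bigl => y; rewrite !inE orbC.
Qed.

Lemma path_weight_root_sym a : a \in C -> a != v0 -> pw v0 a = pw a v0.
Proof.
move=> aC av0; rewrite path_weight_from_root (hat_below aC av0 aC (belowxx aC av0)).
rewrite path_weight_root // mulrC; congr (_ * _).
by rewrite (eqP (belowxx aC av0)) gammaxx //= mulr1.
Qed.

Lemma path_weight_root_root : pw v0 v0 = 1.
Proof. by rewrite path_weight_from_root gammaxx. Qed.

Hypothesis g_away : forall v, v \in C -> v != v0 -> forall y, y \in nb v -> y != parent v ->
  1 <= g v y.

Lemma g_parent_neq0 v : v \in C -> v != v0 -> g (parent v) v != 0.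
Proof.
move=> vC vv0; case: (eqVneq (parent v) v0) => [e|pv].
  by rewrite e g_root // -e nbrs_parent.
apply: lt0r_neq0; apply: Order.POrderTheory.lt_le_trans (g_away _ _ _ _) => //.
- exact: parent_cells.
- exact: nbrs_parent.
- by rewrite eq_sym grandparent_neq.
Qed.

(** The path runs through v0, where all decorations are 1. Formally, both sides obey the same
    one-step recursion from v to its parent, and the common nonzero factor is cancelled. *)
Lemma path_weight_other_branch v a : v \in C -> v != v0 -> a \in C -> branch v != branch a ->
  pw v a = pw v v0 * pw v0 a.
Proof.
move=> + + aC; move: v.
suff br v : v \in C -> v != v0 -> (branch v != branch a -> pw v a = pw v v0 * pw v0 a).
  by move=> v vC vv0; apply: br.
apply: (rooted_ind (P := fun v => branch v != branch a -> pw v a = pw v v0 * pw v0 a)) => {}v vC vv0 pv.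
  move=> bva; apply: (mulfI (g_parent_neq0 vC vv0)); rewrite [RHS]mulrA.
  rewrite (path_weight_step vC v0C (gamma_parent vC vv0)) (path_weight_step vC aC).
    by rewrite pv path_weight_root_root mulr1.
  by apply: belowN => //; apply: contra bva => /below_branch->.
move=> IH bva; apply: (mulfI (g_parent_neq0 vC vv0)); rewrite [RHS]mulrA.
rewrite (path_weight_step vC v0C (gamma_parent vC vv0)) (path_weight_step vC aC).
  by rewrite IH ?mulrA // branch_parent.
by apply: belowN => //; apply: contra bva => /below_branch->.
Qed.

Hypothesis g_one : forall v, v \in C -> v != v0 ->
  (#|[set y in nb v | (y != parent v) && (g v y != 1)]| <= 1)%N.

(** The hat weight of a child is that of v times the decorations at v towards its siblings, which is
    the situation of [sum_prod_others]. Its constant 1 becomes 2 because the parent is a neighbour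
    but not a child. *)
Lemma sum_hat_children v : v \in C -> v != v0 ->
  \sum_(c in nb v | c != parent v) hat c v0 = pw v v0 * (#|nb v|%:Z - 2) + hat v v0.
Proof.
move=> vC vv0; pose S := nb v :\ parent v.
have S1 : (#|[set y in S | g v y != 1]| <= 1)%N.
  apply: leq_trans (g_one vC vv0); apply: subset_leq_card; apply/subsetP=> y.
  by rewrite !inE => /andP[/andP[-> ->] ->].
rewrite path_weight_root // (cardsD1 (parent v)) parent_nbrs // -/S.
have -> : wp v [:: parent v] = \prod_(y in S) g v y.
  by apply: eq_bigl => y; rewrite in_setD1 mem_seq1 andbC.
transitivity (\sum_(c in S) (\prod_(y in S | y != c) g v y) * hat v v0).
  apply: eq_big => [c|c /andP[cv cp]]; first by rewrite in_setD1 andbC.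
  rewrite (@hat_child v) //; congr (_ * _); apply: eq_bigl => y.
  by rewrite in_setD1 in_cons mem_seq1 negb_or; case: (y == c); case: (y == _); case: (y \in _).
have -> : Posz (true + #|S|) - 2 = #|S|%:Z - 1 by lia.
by rewrite -mulr_suml sum_prod_others //; ring.
Qed.

(** Each cell contributes the hat weights of its children minus its own. Everything cancels except
    the children of v0, each of hat weight 1. *)
Lemma sum_path_weight_root :
  \sum_(v in C :\ v0) pw v v0 * (#|nb v|%:Z - 2) = - #|nb v0|%:Z.
Proof.
have eq1 v : v \in C :\ v0 -> pw v v0 * (#|nb v|%:Z - 2) =
    \sum_(c in nb v | c != parent v) hat c v0 - hat v v0.
  by rewrite in_setD1 => /andP[vv0 vC]; rewrite sum_hat_children // addrK.
rewrite (eq_bigr _ eq1) sumrB /=.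
rewrite [X in _ - X](bigID (fun c => parent c == v0)) /=.
have -> : \sum_(c in C :\ v0 | parent c == v0) hat c v0 = #|nb v0|%:Z.
  rewrite (eq_bigl (mem (nb v0))) => [|c]; last first.
    rewrite in_setD1; apply/idP/idP => [/andP[/andP[cv0 cC] /eqP <-]|cv].
      exact: nbrs_parent.
    by rewrite parent_root_child // eqxx (nbrs_cells treeD cv) (nbrs_neq treeD cv).
  by rewrite (eq_bigr (fun=> 1)) ?sumr_const ?natz // => c; apply: hat_root_child.
suff -> : \sum_(v in C :\ v0) \sum_(c in nb v | c != parent v) hat c v0
    = \sum_(c in C :\ v0 | parent c != v0) hat c v0 by ring.
rewrite [RHS](partition_big parent (mem (C :\ v0))) /=; last first.
  by move=> c; rewrite !in_setD1 => /andP[/andP[cv0 cC] ->]; rewrite parent_cells.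
apply: eq_bigr => v; rewrite in_setD1 => /andP[vv0 vC]; apply: eq_bigl => c.
rewrite in_setD1; apply/andP/andP => [[cv cp]|[/andP[/andP[cv0 cC] pc] /eqP pcv]].
  have [cv0 pc] := parent_child vC vv0 cv cp.
  by rewrite pc cv0 (nbrs_cells treeD cv) eqxx.
rewrite -pcv nbrs_parent //; split=> //.
by rewrite eq_sym grandparent_neq // pcv.
Qed.

End OneWeight.

(** * Comparison of the decorations before and after the transform *)

Section TwoWeights.
Variables g g' : T -> T -> int.
Local Notation hat x y := (hat_weight nb g x (ga x y)).
Local Notation hat' x y := (hat_weight nb g' x (ga x y)).
Local Notation pw x y := (path_weight nb g x (ga x y)).
Local Notation pw' x y := (path_weight nb g' x (ga x y)).

Hypothesis g_root : forall y, y \in nb v0 -> g v0 y = 1.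
Hypothesis g_away : forall v, v \in C -> v != v0 -> forall y, y \in nb v -> y != parent v ->
  1 <= g v y.
Hypothesis g'_away : forall v, v \in C -> v != v0 -> forall y, y \in nb v -> y != parent v ->
  g' v y = g v y.
Hypothesis g'_root_child : forall v, v \in C -> v != v0 -> (1 < #|nb v|)%N -> parent v = v0 ->
  g' v v0 = wprod nb g v [:: v0] - g v v0.
Hypothesis g'_det : forall v, v \in C -> v != v0 -> (1 < #|nb v|)%N -> parent v != v0 ->
  (1 < #|nb (parent v)|)%N ->
  g' (parent v) v * g' v (parent v) - wprod nb g' (parent v) [:: v] * wprod nb g' v [:: parent v] =
  - (g (parent v) v * g v (parent v) - wprod nb g (parent v) [:: v] * wprod nb g v [:: parent v]).

Lemma wprod_away v X : v \in C -> v != v0 -> wprod nb g' v (parent v :: X) = wprod nb g v (parent v :: X).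
Proof.
move=> vC vv0; apply: eq_bigr => y /andP[yv]; rewrite inE negb_or => /andP[yp _].
exact: g'_away.
Qed.

Lemma card_nbrs_gt1 v x y : x \in nb v -> y \in nb v -> x != y -> (1 < #|nb v|)%N.
Proof.
move=> xv yv xy; apply: (@leq_trans #|[set x; y]|); first by rewrite cards2 xy.
by apply/subset_leq_card/subsetP => z; rewrite in_set2 => /orP[]/eqP->.
Qed.

(** Since the determinant changes sign, adding its two values leaves a linear recursion for the sum:
    with the names set below, a (x + y) = B Q (x1 + y1). In its solution the decorations at v occur
    once and those further along the path occur squared. *)
Lemma parent_weights_add v : v \in C -> v != v0 -> (1 < #|nb v|)%N ->
  g v (parent v) + g' v (parent v) = hat v v0 * pw v v0.
Proof.
move: v; apply: (rooted_ind (P := fun v => (1 < #|nb v|)%N ->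
  g v (parent v) + g' v (parent v) = hat v v0 * pw v v0)) => v vC vv0 pv.
  move=> nv; rewrite path_weight_root // hat_root_child //; last by rewrite -pv nbrs_parent.
  by rewrite pv g'_root_child //; ring.
move=> IH nv; have pC := parent_cells vC vv0.
have vp := nbrs_parent vC vv0.
have ppp := parent_nbrs pC pv.
have npv := grandparent_neq vC vv0 pv.
have np := card_nbrs_gt1 ppp vp npv.
apply: (mulfI (g_parent_neq0 g_root g_away vC vv0)).
have vpp : v != parent (parent v) by rewrite eq_sym.
have := g'_det vC vv0 nv pv np; rewrite (g'_away pC pv vp) // wprod_away //.
have [p1 p2] : parent (parent v) \notin [:: v] /\ v \notin [:: parent (parent v)].
  by rewrite !mem_seq1.
rewrite !(wprodD1 _ ppp p1) wprod_away // => det.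
have ew : wprod nb g (parent v) [:: v; parent (parent v)] =
          wprod nb g (parent v) [:: parent (parent v); v].
  by apply: eq_bigl => y; rewrite !inE orbC.
move: (IH np); rewrite !path_weight_root // (wprodD1 _ vp p2) ew => sum.
rewrite (hat_child g pC pv vp vpp) ew.
set a := g (parent v) v in det sum *.
set B := wprod nb g (parent v) _ in det sum *.
set Q := wprod nb g v _ in det sum *.
set x := g' v _ in det *; set y := g v _ in det *.
set x1 := g' _ _ in det sum; set y1 := g _ _ in det sum.
transitivity (Q * B * (y1 + x1)); last by rewrite sum; ring.
apply/eqP; rewrite -subr_eq0; apply/eqP.
transitivity ((a * x - x1 * B * Q) + (a * y - y1 * B * Q)); first ring.
by rewrite det; ring.
Qed.

(** On the way down from v only decorations pointing away from the root are incident, and these are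
    preserved. *)
Lemma hat_below_away v a : v \in C -> v != v0 -> a \in C -> below v a ->
  hat' (parent v) a = hat (parent v) a.
Proof.
move=> + + aC; have [n] := ubnP (size (ga v a)).
elim: n v => // n IH v sz vC vv0 bva; rewrite (eqP bva) /= wprod_away //; congr (_ * _).
case: (eqVneq v a) => [->|va]; first by rewrite gammaxx.
have pN := gamma_consN treeD (parent_cells vC vv0) aC (eqP bva).
have [z zv e] := gamma_neq treeD vC aC va.
have zp : z != parent v by apply: contraNneq pN => <-; rewrite e mem_head.
have [z0 pz] := parent_child vC vv0 zv zp.
have := IH z; rewrite pz; apply=> //.
- by move: sz; rewrite e.
- exact: nbrs_cells zv.
- by rewrite /below pz e.
Qed.

(** If a is below v, the only factor that changes is the decoration at v towards its parent, and
    [parent_weights_add] applies. Otherwise the path first climbs to the parent, and both weights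
    acquire the same factors. That a has at most one neighbour keeps the climb from ending at a
    itself. *)
Lemma path_weight_same_branch v a : v \in C -> v != v0 -> a \in C -> a != v0 ->
    (#|nb a| <= 1)%N -> v != a -> branch v = branch a ->
  pw' v a + pw v a = pw v v0 * pw v0 a.
Proof.
move=> + + aC av0 na; move: v.
have base v : v \in C -> v != v0 -> v != a -> below v a -> pw' v a + pw v a = pw v v0 * pw v0 a.
  move=> vC vv0 va bva; rewrite (path_below g' vC vv0 aC va bva) (path_below g vC vv0 aC va bva).
  rewrite hat_below_away // path_weight_from_root //.
  rewrite (hat_below _ vC vv0 aC bva) // -mulrDl [g' _ _ + _]addrC parent_weights_add //; first ring.
  have pN := gamma_consN treeD (parent_cells vC vv0) aC (eqP bva).
  have [z zv e] := gamma_neq treeD vC aC va.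
  apply: card_nbrs_gt1 zv (parent_nbrs vC vv0) _.
  by apply: contraNneq pN => <-; rewrite e mem_head.
suff br v : v \in C -> v != v0 -> (v != a -> branch v = branch a -> pw' v a + pw v a = pw v v0 * pw v0 a).
  by move=> v vC vv0; apply: br.
apply: (rooted_ind (P := fun v => v != a -> branch v = branch a ->
  pw' v a + pw v a = pw v v0 * pw v0 a)) => {}v vC vv0 pv.
  move=> va bv; apply: base => //; rewrite /below pv gamma_branch // -bv.
  by rewrite branch_root_child // -pv nbrs_parent.
move=> IH va bv; have [/base->//|nb_va] := boolP (below v a).
have e := belowN vC vv0 aC nb_va.
have pC := parent_cells vC vv0.
have vp := nbrs_parent vC vv0.
have pa : parent v != a.
  apply: contraTneq na => <-; rewrite -ltnNge.
  by apply: card_nbrs_gt1 vp (parent_nbrs pC pv) _; rewrite eq_sym grandparent_neq.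
apply: (mulfI (g_parent_neq0 g_root g_away vC vv0)).
rewrite mulrDr [RHS]mulrA (path_weight_step g vC aC e).
rewrite (path_weight_step g vC v0C (gamma_parent vC vv0)).
rewrite -(g'_away pC pv vp); last by rewrite eq_sym grandparent_neq.
rewrite (path_weight_step g' vC aC e) wprod_away // -mulrDr IH ?mulrA //.
by rewrite branch_parent.
Qed.

End TwoWeights.
End RootedTrees.

(** * Cells, paths and weights of one tree T_u *)

Section Subtrees.
Variables (T : finType) (D : dtree T) (v0 u : T) (q : {set option T} -> option T -> int).
Hypothesis treeD : is_tree D.
Hypothesis v0C : v0 \in cells D.
Hypothesis uv0 : u \in nbrs D v0.

Local Notation C := (cells D).
Local Notation nb := (nbrs D).
Local Notation ga := (gamma D).
Local Notation Cu := (Defs.comp D v0 u).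
Local Notation S := (Tsub D v0 u q).

(* The cells of T_u are those of the branch at u together with the root v0,
   which becomes the new arrow None. *)
Definition lift_root (x : T) : option T := if x == v0 then None else Some x.
Local Notation lr := lift_root.

Lemma lift_root_inj : injective lr.
Proof. by move=> x y; rewrite /lr; do 2![case: eqP => [->|_]] => // -[]. Qed.

Lemma lift_rootN x : x != v0 -> lr x = Some x.
Proof. by rewrite /lr => /negPf->. Qed.

Lemma lift_root0 : lr v0 = None.
Proof. by rewrite /lr eqxx. Qed.

Lemma in_comp x : x \in Cu -> [/\ x \in C, x != v0 & branch D v0 x = u].
Proof. by rewrite comp_branch // => /and3P[? ? /eqP]. Qed.

Lemma comp_nbrs x y : x \in Cu -> y \in nb x -> y != v0 -> y \in Cu.
Proof.
move=> xu; have [_ xv0 _] := in_comp xu; move: xu; rewrite !inE => xu xy yv0.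
apply: connect_trans xu (connect1 _); rewrite /redrel xy !inE negb_or.
by rewrite ![v0 == _]eq_sym xv0 yv0.
Qed.

Lemma comp_root_nbr x : x \in Cu -> (v0 \in nb x) = (x == u).
Proof.
move=> xu; have [_ xv0 bx] := in_comp xu; rewrite nbrs_sym; apply/idP/eqP => [xr|->//].
by rewrite -bx branch_root_child.
Qed.

Lemma Tsub_edge_Some x y :
  ([set Some x; Some y] \in dE S) = [&& [set x; y] \in dE D, x \in Cu & y \in Cu].
Proof.
rewrite /= in_setU1; have -> : ([set Some x; Some y] == [set None; Some u]) = false.
  by apply/eqP => /setP/(_ None); rewrite !inE.
have -> : [set Some x; Some y] = Some @: [set x; y] :> {set option T}.
  by rewrite imsetU !imset_set1.
rewrite /= mem_imset; last by apply: imset_inj => ? ? [].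
by rewrite [LHS]inE subUset !sub1set.
Qed.

Lemma Tsub_edge_None x : ([set Some x; None] \in dE S) = (x == u).
Proof.
rewrite /= in_setU1 orbC; case: imsetP => [[e _ /setP/(_ None)]|_] /=.
  by rewrite !inE eqxx orbT => /esym/imsetP[].
apply/eqP/eqP => [/setP/(_ (Some u))|->]; last by rewrite setUC.
by rewrite !inE eqxx orbT orbF => /eqP[].
Qed.

(** Cutting at v0 loses no edge at a cell of the branch: its neighbours stay in the branch, except
    that u is adjacent to v0, and that edge is replaced by the one to the new arrow. *)
Lemma nbrs_Tsub x : x \in Cu -> nbrs S (Some x) = lr @: nb x.
Proof.
move=> xu; apply/setP=> -[y|]; rewrite in_nbrs; last first.
  rewrite Tsub_edge_None -comp_root_nbr // -lift_root0 mem_imset //.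
  exact: lift_root_inj.
rewrite Tsub_edge_Some -in_nbrs xu /=; case: (eqVneq y v0) => [->|yv0].
  have -> : (v0 \in Cu) = false by apply/negP => /in_comp[_]; rewrite eqxx.
  rewrite andbF; apply/esym/imsetP => -[z _]; rewrite /lr.
  by case: eqP => // zv0 [/esym].
rewrite -(lift_rootN yv0) mem_imset; last exact: lift_root_inj.
by case: (boolP (y \in nb x)) => //= yx; apply: comp_nbrs yx yv0.
Qed.

Lemma cells_Tsub_None : None \in cells S.
Proof. by rewrite /cells /= !inE /= orbT. Qed.

Lemma cells_Tsub_Some x : (Some x \in cells S) = (x \in Cu).
Proof.
rewrite /cells /= !in_setU !mem_imset; try by move=> ? ? [].
rewrite in_set1 /= !in_setI -andb_orl -in_setU andb_idl //.
by move/in_comp=> [].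
Qed.

(** A connecting walk that avoids v0, once shortened, is the unique path, so the path avoids v0 as
    well. *)
Lemma comp_gamma x y : x \in Cu -> y \in Cu -> path (redrel D v0) x (ga x y).
Proof.
move=> xu yu; have [xC _ _] := in_comp xu.
have rsym : symmetric (redrel D v0) by move=> a b; rewrite /redrel setUC.
have : connect (redrel D v0) x y.
  move: xu yu; rewrite !inE [connect _ u x](sym_connect_sym rsym); apply: connect_trans.
case/connectP=> s0 ps0 ->; case/shortenP: ps0 => s ps us _ {s0}.
by rewrite path_gamma //; apply: sub_path ps => a b /andP[].
Qed.

Lemma redrel_path_comp x s : x \in Cu -> path (redrel D v0) x s -> {subset x :: s <= Cu}.
Proof.
elim: s x => [|y s IH] x xu /=; first by move=> _ z; rewrite inE => /eqP->.
case/andP=> xy ps z; rewrite in_cons => /orP[/eqP->//|zs].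
apply: (IH y) => //; move: xu; rewrite !inE => xu.
by apply: connect_trans xu (connect1 xy).
Qed.

Lemma redrel_path_Tsub x s : x \in Cu -> path (redrel D v0) x s ->
  path (fun a b => [set a; b] \in dE S) (Some x) (map Some s).
Proof.
elim: s x => //= y s IH x xu /andP[xy ps].
have yu : y \in Cu by apply: (@redrel_path_comp x [:: y]); rewrite //= ?xy // !inE eqxx orbT.
by rewrite IH // andbT Tsub_edge_Some xu yu; case/andP: xy => ->.
Qed.

Lemma root_in_comp : u \in Cu. Proof. by rewrite inE connect0. Qed.

Hypothesis treeS : is_tree S.

Lemma gamma_Tsub x y : x \in Cu -> y \in Cu -> gamma S (Some x) (Some y) = map Some (ga x y).
Proof.
move=> xu yu; have [[xC _ _] [yC _ _]] := (in_comp xu, in_comp yu).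
have -> : Some y = last (Some x) (map Some (ga x y)) by rewrite last_map gamma_last.
apply: path_gamma => //; first by rewrite cells_Tsub_Some.
  by apply: redrel_path_Tsub => //; apply: comp_gamma.
by rewrite -map_cons map_inj_uniq ?gamma_uniq // => ? ? [].
Qed.

Lemma gamma_Tsub_None y : y \in Cu -> gamma S None (Some y) = map Some (ga v0 y).
Proof.
move=> yu; have [yC yv0 bY] := in_comp yu.
rewrite (gamma_branch treeD v0C yC yv0) bY.
have [uC _ _] := in_comp root_in_comp.
have -> : Some y = last None (map Some (u :: ga u y)) by rewrite /= last_map gamma_last.
apply: path_gamma => //; first exact: cells_Tsub_None.
  apply/andP; split; first by rewrite setUC Tsub_edge_None.
  by apply: redrel_path_Tsub; rewrite ?comp_gamma // root_in_comp.
rewrite cons_uniq map_inj_uniq ?gamma_uniq // ?andbT => [|? ? []//].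
by apply/mapP => -[].
Qed.

Lemma gamma_Tsub_to_None x : x \in Cu -> gamma S (Some x) None = map lr (ga x v0).
Proof.
move=> xu; have [xC xv0 bx] := in_comp xu.
have -> : None = last (lr x) (map lr (ga x v0)) by rewrite last_map gamma_last // lift_root0.
rewrite -{1}(lift_rootN xv0); apply: path_gamma => //.
- by rewrite lift_rootN // cells_Tsub_Some.
- move: bx {xu}; move: x xC xv0.
  apply: (rooted_ind treeD v0C (P := fun x => branch D v0 x = u ->
    path (fun a b => [set a; b] \in dE S) (lr x) (map lr (ga x v0)))) => x xC xv0 px.
    move=> bx; rewrite (gamma_parent treeD v0C xC xv0) px gammaxx //= andbT.
    rewrite lift_rootN // lift_root0 Tsub_edge_None -bx branch_root_child //.
    by rewrite -px nbrs_parent.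
  move=> IH bx; have xu : x \in Cu by rewrite comp_branch // xC xv0 bx eqxx.
  rewrite (gamma_parent treeD v0C xC xv0); apply/andP; split; last by apply: IH; rewrite branch_parent.
  rewrite lift_rootN // -in_nbrs nbrs_Tsub // mem_imset ?parent_nbrs //.
  exact: lift_root_inj.
- by rewrite -map_cons map_inj_uniq ?gamma_uniq //; apply: lift_root_inj.
Qed.

Lemma valency_Tsub x : x \in Cu -> valency S (Some x) = #|nb x|.
Proof. by move=> xu; rewrite valency_nbrs // nbrs_Tsub // card_imset //; apply: lift_root_inj. Qed.

Lemma gedges_Tsub_away x y : x \in Cu -> y \in nb x -> y != parent D v0 x ->
  [set Some x; lr y] \notin gedges S None (Some x).
Proof.
move=> xu yx yp; have [xC xv0 bx] := in_comp xu.
have e := gamma_Tsub_to_None xu.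
rewrite (gamma_parent treeD v0C xC xv0) /= in e.
have xS : Some x \in cells S by rewrite cells_Tsub_Some.
have [_ e2] := gamma_consE treeS xS cells_Tsub_None e; rewrite e2 in e.
apply: (gedges_away treeS cells_Tsub_None xS e).
- by rewrite nbrs_Tsub // mem_imset //; apply: lift_root_inj.
- by rewrite (inj_eq lift_root_inj).
Qed.

Section Weights.
Variables (G : option T -> option T -> int) (g : T -> T -> int).
Hypothesis Gg : forall x y, x \in Cu -> y \in nb x -> G (Some x) (lr y) = g x y.

Lemma wprod_Tsub x X : x \in Cu ->
  wprod (nbrs S) G (Some x) (map lr X) = wprod nb g x X.
Proof.
move=> xu; rewrite /wprod nbrs_Tsub // big_mkcondr big_imset /=; last first.
  by move=> ? ? _ _; apply: lift_root_inj.
rewrite -big_mkcondr /=; apply: eq_big => y.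
  by rewrite mem_map //; apply: lift_root_inj.
by case/andP=> yx _; apply: Gg.
Qed.

Lemma map_lift_root s : {subset s <= Cu} -> map lr s = map Some s.
Proof. by move=> su; apply/eq_in_map => x /su/in_comp[_ xv0 _]; apply: lift_rootN. Qed.

Lemma hat_weight_Tsub x s : {subset s <= Cu} ->
  hat_weight (nbrs S) G (lr x) (map Some s) = hat_weight nb g x s.
Proof.
elim: s x => [|w s IH] x su //=.
have wu : w \in Cu by apply: su; rewrite mem_head.
have su' : {subset s <= Cu} by move=> z zs; apply: su; rewrite inE zs orbT.
have [_ wv0 _] := in_comp wu.
rewrite -map_take -(map_lift_root (s := take 1 s)) -?map_cons ?wprod_Tsub //.
  by rewrite -(lift_rootN wv0) IH.
by move=> z /mem_take; apply: su'.
Qed.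

Lemma path_weight_Tsub x y : x \in Cu -> y \in Cu ->
  path_weight (nbrs S) G (Some x) (gamma S (Some x) (Some y)) = path_weight nb g x (ga x y).
Proof.
move=> xu yu; have [_ xv0 _] := in_comp xu.
have su : {subset ga x y <= Cu}.
  move=> z zg; apply: (redrel_path_comp xu (comp_gamma xu yu)).
  by rewrite inE zg orbT.
rewrite gamma_Tsub // /path_weight -{2}(lift_rootN xv0) hat_weight_Tsub //; congr (_ * _).
rewrite -map_take -(map_lift_root (s := take 1 _)) ?wprod_Tsub //.
by move=> z /mem_take; apply: su.
Qed.

(** The only edge at the new arrow lies on the path, so the arrow contributes an empty product. *)
Lemma path_weight_Tsub_None y : y \in Cu ->
  path_weight (nbrs S) G None (gamma S None (Some y)) = hat_weight nb g v0 (ga v0 y).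
Proof.
move=> yu; have [yC yv0 bY] := in_comp yu.
have e := gamma_branch treeD v0C yC yv0; rewrite bY in e.
have su : {subset ga v0 y <= Cu}.
  move=> z; rewrite e => zg.
  exact: (redrel_path_comp root_in_comp (comp_gamma root_in_comp yu)).
rewrite gamma_Tsub_None // /path_weight -{2}lift_root0 hat_weight_Tsub //.
rewrite e /= take0 /wprod big1 ?mul1r // => -[z|] /andP[].
  by rewrite in_nbrs setUC Tsub_edge_None mem_seq1 => /eqP->; rewrite eqxx.
by move/(nbrs_neq treeS).
Qed.

End Weights.

Lemma Tprime_weight x y : x \in Cu -> y \in nb x ->
  dq (Tprime D v0 u) [set Some x; lr y] (Some x) = edge_weight D x y.
Proof.
move=> xu yx; have [xC xv0 bx] := in_comp xu; rewrite /edge_weight /=.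
case: (eqVneq y v0) yx => [->|yv0] yx.
  rewrite comp_root_nbr // in yx; rewrite lift_root0 (eqP yx) setUC eqxx.
  by rewrite setUC.
rewrite lift_rootN // ifF; last by apply/eqP => /setP/(_ None); rewrite !inE.
by congr (dq D _ _); apply/setP=> z; rewrite !inE.
Qed.

Lemma Anz_Tsub : Anz S = Some @: (Anz D :&: Cu).
Proof.
apply/setP=> -[y|]; rewrite /Anz /A0 /=; last first.
  have NS (X : {set T}) : (None \in Some @: X) = false by apply/imsetP => -[].
  by rewrite NS !inE eqxx.
rewrite mem_imset; last by move=> ? ? [].
rewrite !inE !mem_imset ?inE //=; last by move=> ? ? [].
by case: (y \in dA D); rewrite ?andbF //; case: connect; rewrite ?andbF ?andbT.
Qed.

Lemma VA0_Tsub : dV S :|: A0 S = None |: Some @: ((dV D :|: A0 D) :&: Cu).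
Proof.
apply/setP=> -[y|]; rewrite /A0 /=; last by rewrite !inE eqxx /= orbT.
rewrite !inE /= !mem_imset; try by move=> ? ? [].
by rewrite !inE; case: connect; rewrite ?andbF ?andbT.
Qed.

End Subtrees.

Lemma sum_comp (T : finType) (D : dtree T) (v0 : T) (Y : {set T}) (F : T -> int) :
    is_tree D -> v0 \in cells D -> Y \subset cells D ->
  \sum_(u in nbrs D v0) \sum_(v in Y :&: Defs.comp D v0 u) F v = \sum_(v in Y :\ v0) F v.
Proof.
move=> treeD v0C /subsetP YC.
rewrite [RHS](partition_big (branch D v0) (mem (nbrs D v0))) /=; last first.
  by move=> v; rewrite in_setD1 => /andP[vv0 /YC vC]; apply: branch_nbrs.
apply: eq_bigr => u uv0; apply: eq_bigl => v; rewrite in_setI in_setD1 comp_branch //.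
by case: (boolP (v \in Y)) => [/YC->|]; rewrite ?andbF //= andbT.
Qed.

(** Each gcd has f = 1 as an argument, so its value is 1 whatever p is. *)
Lemma Ft_card (T : finType) (D : dtree T) :
  (forall a, a \in dA D -> df D a = 0 \/ df D a = 1) -> Ft D = #|Anz D|%:Z.
Proof.
move=> f01; rewrite /Ft (eq_bigr (fun=> 1)) ?sumr_const ?natz // => a.
rewrite !inE => /andP[+ aA]; rewrite aA /Ff => /=.
by case: (f01 a aA) => ->; rewrite ?eqxx // gcd1z.
Qed.

(** * All branches together, and the final count *)

Section Transforms.
Variables (T : finType) (D : dtree T) (v0 : T) (qs : T -> {set option T} -> option T -> int).
Hypothesis decD : is_decorated_tree D.
Hypothesis rootD : is_root D v0.
Hypothesis transf : forall u, u \in nbrs D v0 -> is_transform (Tprime D v0 u) None (qs u).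

Local Notation C := (cells D).
Local Notation nb := (nbrs D).
Local Notation ga := (gamma D).
Local Notation par := (parent D v0).
Local Notation lr := (lift_root v0).
Local Notation Cu := (Defs.comp D v0).
Local Notation S u := (Tsub D v0 u (qs u)).
Local Notation g := (edge_weight D).

(** Glues the new decorations of all branches into one weight on T: those at w are read in the tree
    of the branch containing w. *)
Definition transform_weight (w y : T) : int := qs (branch D v0 w) [set lr w; lr y] (lr w).
Local Notation g' := transform_weight.

Let treeD : is_tree D. Proof. by case: decD. Qed.
Let v0V : v0 \in dV D. Proof. by case: rootD. Qed.
Let v0C : v0 \in C. Proof. by rewrite in_setU v0V. Qed.

Let treeS u : u \in nb v0 -> is_tree (S u).
Proof. by move=> /transf[[]]. Qed.

Let branchC v : v \in C -> v != v0 -> v \in Cu (branch D v0 v).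
Proof. by move=> vC vv0; rewrite comp_branch ?branch_nbrs // vC vv0 eqxx. Qed.

Lemma card_nbrs_arrow a : a \in dA D -> #|nb a| = 1%N.
Proof. by case: decD => _ _ val1 _ _ /val1; rewrite valency_nbrs. Qed.

(** The defining relations of the transform concern vertices only. Having two neighbours forces a
    cell to be a vertex, which lets those relations be stated through neighbours alone. *)
Lemma nbrs_gt1_vertex v : v \in C -> (1 < #|nb v|)%N -> v \in dV D.
Proof. by rewrite in_setU => /orP[//|/card_nbrs_arrow->]. Qed.

Lemma away_vertex v y : v \in C -> v != v0 -> y \in nb v -> y != par v -> v \in dV D.
Proof.
move=> vC vv0 yv yp; apply: nbrs_gt1_vertex => //.
exact: (card_nbrs_gt1 yv (parent_nbrs treeD v0C vC vv0) yp).
Qed.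

Lemma edge_weight_root y : y \in nb v0 -> g v0 y = 1.
Proof. by rewrite in_nbrs => vy; case: rootD => _ + _; apply=> //; apply: set21. Qed.

Lemma edge_weight_away v : v \in C -> v != v0 -> forall y, y \in nb v -> y != par v -> 1 <= g v y.
Proof.
move=> vC vv0 y yv yp; have vV := away_vertex vC vv0 yv yp.
case: rootD => _ _ /(_ v vV vv0)[+ _]; apply.
- by rewrite -in_nbrs.
- exact: set21.
- exact: gedges_away (gamma_parent treeD v0C vC vv0) yv yp.
Qed.

Lemma edge_weight_one v : v \in C -> v != v0 ->
  (#|[set y in nb v | (y != par v) && (g v y != 1)]| <= 1)%N.
Proof.
(* The root condition is available at vertices only. An element of the set is a neighbour other than
   the parent, so it makes v a vertex; for an empty set the bound is clear. *)
move=> vC vv0; case: (set_0Vmem [set y in nb v | (y != par v) && (g v y != 1)]) => [->|[y0]].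
  by rewrite cards0.
rewrite in_set => /and3P[y0v y0p _]; have vV := away_vertex vC vv0 y0v y0p.
case: rootD => _ _ /(_ v vV vv0)[_]; apply: leq_trans.
rewrite -(card_in_imset (f := fun y => [set v; y])); last first.
  move=> y z; rewrite !in_set -!in_nbrs => /andP[yv _] _ /setP/(_ y).
  by rewrite !inE eqxx orbT (negPf (nbrs_neq treeD yv)) /= => /esym/eqP.
apply/subset_leq_card/subsetP => e /imsetP[y + ->]; rewrite in_set => /and3P[yv yp gy].
rewrite in_set -in_nbrs yv set21 gy /= andbT.
exact: gedges_away (gamma_parent treeD v0C vC vv0) yv yp.
Qed.

Lemma transform_weightE u : u \in nb v0 -> forall x y, x \in Cu u -> y \in nb x ->
  edge_weight (S u) (Some x) (lr y) = g' x y.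
Proof.
move=> uv0 x y xu yx; have [_ xv0 bx] := in_comp treeD v0C uv0 xu.
by rewrite /transform_weight bx (lift_rootN xv0).
Qed.

Lemma edge_weight_Tprime u : u \in nb v0 -> forall x y, x \in Cu u -> y \in nb x ->
  edge_weight (Tprime D v0 u) (Some x) (lr y) = g x y.
Proof. by move=> uv0 x y xu yx; rewrite /edge_weight Tprime_weight. Qed.

Lemma Some_dV_Tprime u x : x \in Cu u -> x \in dV D -> Some x \in dV (Tprime D v0 u).
Proof. by move=> xu xV; apply: imset_f; rewrite in_setI xV. Qed.

Lemma Qc_Tprime u x y : u \in nb v0 -> x \in Cu u -> y \in nb x ->
  Qc (Tprime D v0 u) [set Some x; lr y] (Some x) = wprod nb g x [:: y].
Proof.
(* Being a tree does not involve decorations, so [treeS] also serves for [Tprime], which is [Tsub]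
   with its original decorations. *)
move=> uv0 xu yx; rewrite (Qc_wprod (D := Tprime D v0 u) (treeS uv0)).
  exact: (wprod_Tsub (dq (Tprime D v0 u)) treeD v0C uv0 (edge_weight_Tprime uv0) [:: y] xu).
rewrite (nbrs_Tsub (dq (Tprime D v0 u)) treeD v0C uv0 xu) mem_imset //.
exact: lift_root_inj.
Qed.

Lemma Qc_Tsub u x y : u \in nb v0 -> x \in Cu u -> y \in nb x ->
  Qc (S u) [set Some x; lr y] (Some x) = wprod nb g' x [:: y].
Proof.
move=> uv0 xu yx; rewrite (Qc_wprod (treeS uv0)).
  exact: (wprod_Tsub (qs u) treeD v0C uv0 (transform_weightE uv0) [:: y] xu).
rewrite nbrs_Tsub // mem_imset //; exact: lift_root_inj.
Qed.

Lemma transform_weight_away v : v \in C -> v != v0 -> forall y, y \in nb v -> y != par v ->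
  g' v y = g v y.
Proof.
move=> vC vv0 y yv yp; have vV := away_vertex vC vv0 yv yp.
have uv0 := branch_nbrs treeD v0C vC vv0; have vu := branchC vC vv0.
case: (transf uv0) => _ _ + _ _ => /(_ (Some v) [set Some v; lr y]).
rewrite /transform_weight (lift_rootN vv0) => ->.
- by rewrite Tprime_weight.
- exact: Some_dV_Tprime.
- by [].
- rewrite -in_nbrs (nbrs_Tsub (dq (Tprime D v0 _)) treeD v0C uv0 vu) mem_imset //.
  exact: lift_root_inj.
- exact: set21.
- exact: (gedges_Tsub_away treeD v0C uv0 (treeS uv0)).
Qed.

Lemma transform_weight_root_child v : v \in C -> v != v0 -> (1 < #|nb v|)%N -> par v = v0 ->
  g' v v0 = wprod nb g v [:: v0] - g v v0.
Proof.
move=> vC vv0 nv pv; have vV := nbrs_gt1_vertex vC nv.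
have uv0 := branch_nbrs treeD v0C vC vv0; have vu := branchC vC vv0.
have v0v : v0 \in nb v by rewrite -pv parent_nbrs.
case: (transf uv0) => _ _ _ /(_ (Some v)) + _; rewrite setUC.
rewrite /transform_weight (lift_rootN vv0) (lift_root0 v0) => ->.
- by rewrite -(lift_root0 v0) Qc_Tprime // Tprime_weight.
- exact: Some_dV_Tprime.
- rewrite (Tsub_edge_None D v0 _ (dq (Tprime D v0 _))).
  by rewrite branch_root_child // nbrs_sym.
Qed.

Lemma transform_weight_det v : v \in C -> v != v0 -> (1 < #|nb v|)%N -> par v != v0 ->
  (1 < #|nb (par v)|)%N ->
  g' (par v) v * g' v (par v) - wprod nb g' (par v) [:: v] * wprod nb g' v [:: par v] =
  - (g (par v) v * g v (par v) - wprod nb g (par v) [:: v] * wprod nb g v [:: par v]).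
Proof.
move=> vC vv0 nv pv np; have vV := nbrs_gt1_vertex vC nv.
have pC := parent_cells treeD v0C vC vv0; have pV := nbrs_gt1_vertex pC np.
have uv0 := branch_nbrs treeD v0C vC vv0; have vu := branchC vC vv0.
have pu := branchC pC pv; rewrite branch_parent // in pu.
have pn := parent_nbrs treeD v0C vC vv0; have np' := nbrs_parent treeD v0C vC vv0.
case: (transf uv0) => _ _ _ _ /(_ (Some (par v)) (Some v)) det.
have := Qc_Tsub uv0 pu np'; have := Qc_Tsub uv0 vu pn.
have := Qc_Tprime uv0 pu np'; have := Qc_Tprime uv0 vu pn.
have := transform_weightE uv0 pu np'; have := transform_weightE uv0 vu pn.
have := edge_weight_Tprime uv0 pu np'; have := edge_weight_Tprime uv0 vu pn.
rewrite /edge_weight (lift_rootN vv0) (lift_rootN pv) ![[set Some v; _]]setUC.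
do 8![move=> <-]; apply: det => //; try exact: Some_dV_Tprime.
rewrite (Tsub_edge_Some D v0 _ (dq (Tprime D v0 _))) vu pu -in_nbrs.
by rewrite np'.
Qed.

Local Notation N := (Nv D).
Local Notation m v := (path_weight nb g v (ga v v0)).
Local Notation d := (degT D v0).

Let AnzC a : a \in Anz D -> a \in C.
Proof. by rewrite in_setD => /andP[_ aA]; rewrite in_setU aA orbT. Qed.

Let AnzA a : a \in Anz D -> a \in dA D.
Proof. by rewrite in_setD => /andP[]. Qed.

Let disjVA a : a \in dA D -> a \notin dV D.
Proof. by case: decD => /disjoint_setI0/setP/(_ a) + _ _ _ _ aA; rewrite !inE aA andbT => ->. Qed.

Let Anz_neq a : a \in Anz D -> a != v0.
Proof. by move/AnzA/disjVA; apply: contraNneq => ->. Qed.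

Let dfS u y : df (S u) (Some y) = df D y. Proof. by []. Qed.

Lemma Nv_Tsub u v : u \in nb v0 -> v \in Cu u -> v \in dV D :|: A0 D ->
  Nv (S u) (Some v) = m v * d - N v.
Proof.
move=> uv0 vu vX; have [vC vv0 bv] := in_comp treeD v0C uv0 vu.
rewrite /Nv Anz_Tsub big_imset /=; last by move=> ? ? _ _ [].
rewrite /degT /Nv mulr_sumr -sumrB (bigID (mem (Cu u)) (mem (Anz D))) /=.
(* Arrows of other branches are absent from T_u, and for them m v times x_{v0,a} minus x_{v,a}
   vanishes. *)
rewrite [X in _ = _ + X]big1 ?addr0; last first.
  move=> a /andP[az aNu]; have aC := AnzC az.
  rewrite !xvE // (path_weight_other_branch treeD v0C edge_weight_root edge_weight_away vC vv0 aC); first by ring.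
  apply: contra aNu => /eqP ba; rewrite comp_branch // aC Anz_neq //=.
  by rewrite -ba bv.
apply: eq_big => [a|a]; first by rewrite in_setI.
rewrite in_setI => /andP[az au]; have aC := AnzC az.
rewrite !xvE ?cells_Tsub_Some //; last exact: treeS.
rewrite dfS (path_weight_Tsub treeD v0C uv0 (treeS uv0) (transform_weightE uv0) vu au).
have [_ _ ba] := in_comp treeD v0C uv0 au.
have va : v != a.
  apply: contraTneq vX => ->; rewrite in_setU negb_or disjVA ?AnzA //=.
  by move: az; rewrite in_setD => /andP[].
have := path_weight_same_branch treeD v0C edge_weight_root edge_weight_away
  transform_weight_away transform_weight_root_child transform_weight_det vC vv0 aC (Anz_neq az).
rewrite card_nbrs_arrow ?AnzA // => /(_ isT va (etrans bv (esym ba))) e.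
transitivity (df D a * (path_weight nb g' v (ga v a) + path_weight nb g v (ga v a) -
  path_weight nb g v (ga v a))); first by ring.
by rewrite e; ring.
Qed.

(** Seen from the root, a path into the branch meets only decorations pointing away from it, which
    the transform keeps. *)
Lemma Nv_Tsub_None u : u \in nb v0 ->
  Nv (S u) None = \sum_(a in Anz D :&: Cu u) xv D v0 a.
Proof.
move=> uv0; rewrite /Nv Anz_Tsub big_imset /=; last by move=> ? ? _ _ [].
apply: eq_bigr => a; rewrite in_setI => /andP[az au]; have aC := AnzC az.
rewrite !xvE ?cells_Tsub_Some ?cells_Tsub_None //; last exact: treeS.
rewrite dfS (path_weight_Tsub_None treeD v0C uv0 (treeS uv0) (transform_weightE uv0) au).
rewrite (path_weight_from_root edge_weight_root); congr (_ * _).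
have [_ av0 ba] := in_comp treeD v0C uv0 au.
have uC := nbrs_cells treeD uv0; have uNv0 := nbrs_neq treeD uv0.
have := hat_below_away treeD v0C transform_weight_away uC uNv0 aC.
rewrite parent_root_child //; apply.
by rewrite /below parent_root_child // gamma_branch // ba.
Qed.

Local Notation k v := (#|nb v|%:Z - 2).

Lemma Mt_Tsub u : u \in nb v0 ->
  Mt (S u) = \sum_(a in Anz D :&: Cu u) xv D v0 a
    - \sum_(v in (dV D :|: A0 D) :&: Cu u) (m v * d - N v) * k v.
Proof.
move=> uv0; rewrite /Mt VA0_Tsub big_setU1 /=; last by apply/imsetP => -[].
rewrite big_imset /=; last by move=> ? ? _ _ [].
have -> : valency (S u) None = 1%N.
  by case: (transf uv0) => -[_ _ val1 _ _] _ _ _ _; apply: val1; rewrite /= setU11.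
have eN v : v \in (dV D :|: A0 D) :&: Cu u ->
    Nv (S u) (Some v) * ((valency (S u) (Some v))%:Z - 2) = (m v * d - N v) * k v.
  rewrite in_setI => /andP[vX vu].
  by rewrite Nv_Tsub // valency_Tsub //; apply: treeS.
by rewrite (eq_bigr _ eN) Nv_Tsub_None //; ring.
Qed.

Let X := dV D :|: A0 D.

Let XC : X \subset C.
Proof.
apply/subsetP=> v; rewrite !inE => /orP[->//|/andP[-> _]].
by rewrite orbT.
Qed.

Let AnzD1 : Anz D :\ v0 = Anz D.
Proof.
apply/setP=> a; rewrite in_setD1; case: (boolP (a \in Anz D)) => [/Anz_neq->|] //.
by rewrite andbF.
Qed.

Let sum_cells (F : T -> int) :
  \sum_(v in C :\ v0) F v = \sum_(v in X :\ v0) F v + \sum_(a in Anz D) F a.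
Proof.
rewrite (big_setID (Anz D)) addrC /=; congr (_ + _); apply: eq_bigl => v.
  by rewrite in_setI in_setD1 andb_idl // => va; rewrite AnzC ?Anz_neq.
rewrite !inE; have := @disjVA v; case: (v \in dA D) => [/(_ isT)/negPf->|_] //=.
by case: (df D v == 0); case: (v == v0).
Qed.

Hypothesis f01 : forall a, a \in dA D -> df D a = 0 \/ df D a = 1.

Let xv_root a : a \in Anz D -> xv D v0 a = m a.
Proof.
move=> az; have aC := AnzC az; rewrite xvE //.
have -> : df D a = 1.
  by move: az; rewrite !inE => /andP[+ aA]; rewrite aA; case: (f01 aA) => ->; rewrite ?eqxx.
by rewrite mul1r (path_weight_root_sym treeD v0C edge_weight_root aC (Anz_neq az)).
Qed.

(** The telescoped sum covers all non-root cells. The arrows with f = 1 have valency 1 and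
    contribute - m a = - x_{v0,a} each, so leaving them out adds d. *)
Lemma sum_root_weights : \sum_(v in X :\ v0) m v * k v = d - #|nb v0|%:Z.
Proof.
have := sum_path_weight_root treeD v0C edge_weight_root edge_weight_one.
rewrite sum_cells => e; apply: (addIr (\sum_(a in Anz D) m a * k a)); rewrite e.
rewrite /degT /Nv [RHS]addrAC -big_split /= big1 ?add0r // => a az.
by rewrite xv_root // card_nbrs_arrow ?AnzA //; ring.
Qed.

(** With n the valency of v0, the root term of - M(T) is d (n - 2). The new arrows, of valency 1,
    contribute d to the sum of the M(T_u), and [sum_root_weights] times d gives d (d - n). The terms
    with n cancel, and 3 is 2 + 1. *)
Lemma Mt_transforms :
  - Mt D = d ^+ 2 - 3 * d + \sum_(u in nb v0) Mt (S u).
Proof.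
rewrite (eq_bigr _ Mt_Tsub) sumrB !sum_comp //; last first.
  by apply/subsetP=> a /AnzC.
rewrite AnzD1 -[\sum_(a in Anz D) _]/d.
rewrite /Mt opprK (big_setD1 v0) /=; last by rewrite in_setU v0V.
rewrite (eq_bigr (fun v => N v * k v)) => [|v _]; last by rewrite valency_nbrs.
rewrite valency_nbrs // -/d.
have -> : \sum_(v in X :\ v0) (m v * d - N v) * k v =
    d * (\sum_(v in X :\ v0) m v * k v) - \sum_(v in X :\ v0) N v * k v.
  by rewrite mulr_sumr -sumrB; apply: eq_bigr => v _; ring.
by rewrite sum_root_weights /degT; ring.
Qed.

Lemma Ft_transforms : Ft D = \sum_(u in nb v0) Ft (S u).
Proof.
rewrite Ft_card // -AnzD1 -[LHS]natz -sumr_const.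
rewrite -(sum_comp _ treeD v0C); last by apply/subsetP=> a /AnzC.
apply: eq_bigr => u uv0; rewrite sumr_const natz Ft_card => [|[a|]]; last by left.
  by rewrite Anz_Tsub card_imset // => ? ? [].
rewrite /= !inE /= mem_imset; last by move=> ? ? [].
by rewrite in_setI => /andP[/f01].
Qed.

End Transforms.

Theorem theorem6p8 (T : finType) (D : dtree T) (v0 : T)
    (qs : T -> {set option T} -> option T -> int) :
  is_decorated_tree D ->
  is_root D v0 ->
  (forall a, a \in dA D -> df D a = 0 \/ df D a = 1) ->
  (0 < valency D v0)%N ->
  (forall u, u \in nbrs D v0 -> is_transform (Tprime D v0 u) None (qs u)) ->
  genus D =
    ((degT D v0 - 1) * (degT D v0 - 2))%:~R / 2
    - \sum_(u in nbrs D v0) deltaT (Tsub D v0 u (qs u)).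
Proof.
move=> decD rootD f01 _ transf.
rewrite /genus /deltaT -mulr_suml -mulrBl; congr (_ / 2).
rewrite -rmorph_sum -rmorphB /=; congr (_%:~R).
rewrite sumrB -Ft_transforms //.
(* What remains is 2 + (d^2 - 3 d) = (d - 1)(d - 2). *)
by rewrite (Mt_transforms decD rootD transf f01); ring.
Qed.
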